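(* For any $n \geq 1$, we have $$\#\{\pi \in \mathfrak{S}_n : \operatorname{asc}(\pi) = \operatorname{is}(\pi) - 1\} = \sum_{\lambda \vdash n} f^{\lambda}\, s_{\lambda'}(1^{\lambda_1}).$$ This sequence of numbers (indexed by $n$) is given by entry A268699 of the On-Line Encyclopedia of Integer Sequences (OEIS).
   Context: $\mathfrak{S}_n$ is the set of permutations of $[n]=\{1,\dots,n\}$. $\operatorname{asc}(\pi)$ is the number of $i\in[n-1]$ with $\pi(i)<\pi(i+1)$, and $\operatorname{is}(\pi)$ is the length of a longest increasing subsequence of $\pi$. The sum is over all partitions $\lambda=(\lambda_1\ge\lambda_2\ge\cdots)$ of $n$; $\lambda'$ denotes the conjugate (transposed) partition. $f^\lambda$ is the number of standard Young tableaux of shape $\lambda$, i.e. fillings of the Young diagram of $\lambda$ with the numbers $1,\dots,n$, each used once, with rows and columns increasing. For $k\ge1$ and any partition $\lambda$, $s_\lambda(1^k)$ is the number of semistandard Young tableaux of shape $\lambda$ (fillings with positive integers whose rows are weakly increasing and columns strictly increasing) with entries in $[k]$. *)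

(* Defs.v *)
From mathcomp Require Import all_boot perm.

Set Implicit Arguments.
Unset Strict Implicit.
Unset Printing Implicit Defensive.

(* The set [n] = {1, ..., n} is rendered by 'I_n = {0, ..., n - 1}, both for
   positions and for values; only the order of the elements matters below. *)

Section PermutationStatistics.

Variables (n : nat) (s : 'S_n).

(* The pairs are those of the form (i, i + 1), so i runs over [n - 1]. *)
Definition asc : nat :=
  #|[set p : 'I_n * 'I_n | (p.2 == p.1.+1 :> nat) && (s p.1 < s p.2)]|.

(* A subsequence is given by its set of positions. *)
Definition increasing_on (A : {set 'I_n}) : bool :=
  [forall i in A, forall j in A, (i < j) ==> (s i < s j)].

Definition lis : nat := \max_(A : {set 'I_n} | increasing_on A) #|A|.

End PermutationStatistics.

(* A shape is a weakly decreasing list of row lengths; trailing zeros are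
   allowed, as in lambda_1 >= lambda_2 >= ... .  A partition of n has at most
   n nonzero parts, all at most n, so padding with zeros to length exactly n
   represents each partition of n once. *)
Definition is_partition_of (n : nat) (sh : seq nat) : bool :=
  sorted geq sh && (sumn sh == n).

Definition intpartn (n : nat) : Type :=
  {l : n.-tuple 'I_n.+1 | is_partition_of n (map val l)}.

Definition parts (n : nat) (la : intpartn n) : seq nat := map val (val la).

Coercion parts : intpartn >-> seq.

Definition first_part (sh : seq nat) : nat := head 0 sh.

Definition conjugate (sh : seq nat) : seq nat :=
  mkseq (fun j => count (fun r => j < r) sh) (first_part sh).

(* Cell (i, j): row i, column j, both counted from 0. *)
Definition cell (sh : seq nat) : Type :=
  {c : 'I_(size sh) * 'I_(first_part sh) | c.2 < nth 0 sh c.1}.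

Section Tableaux.

Variable sh : seq nat.

Definition row_of (c : cell sh) : nat := (val c).1.
Definition col_of (c : cell sh) : nat := (val c).2.

Section Filling.

Variables (k : nat) (T : {ffun cell sh -> 'I_k}).

Definition rows_weakly_increasing : bool :=
  [forall c, forall d,
     (row_of c == row_of d) && (col_of c < col_of d) ==> (T c <= T d)].

Definition rows_increasing : bool :=
  [forall c, forall d,
     (row_of c == row_of d) && (col_of c < col_of d) ==> (T c < T d)].

Definition cols_increasing : bool :=
  [forall c, forall d,
     (col_of c == col_of d) && (row_of c < row_of d) ==> (T c < T d)].

Definition each_used_once : bool :=
  [forall v : 'I_k, #|[set c | T c == v]| == 1].

End Filling.

Definition num_SYT : nat :=
  #|[set T : {ffun cell sh -> 'I_(sumn sh)} |
      [&& each_used_once T, rows_increasing T & cols_increasing T]]|.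

(* s_sh(1^k) *)
Definition num_SSYT (k : nat) : nat :=
  #|[set T : {ffun cell sh -> 'I_k} |
      rows_weakly_increasing T && cols_increasing T]|.

End Tableaux.

(* Main.v *)
Require Import Defs.
From mathcomp Require Import all_boot perm.
From mathcomp Require Import zify.

(** Sort the positions of a word v of length n over the alphabet [k], smaller
    letters first and equal letters from right to left.  This gives a
    permutation s, and reading v along s gives a weakly increasing word that
    goes up at every ascent of s; so s has at most k - 1 ascents, and its
    increasing subsequences are the strictly increasing subsequences of v.
    Since lis s <= asc s + 1 for every permutation (lis_le_asc), a word that
    contains 0, 1, ..., k - 1 as a subsequence gives lis s = k and
    asc s = k - 1.  Conversely, a permutation with lis s = k = asc s + 1 comes
    from exactly one such word: its letter at position s i must be the number
    of ascents of s before i (card_perms_words).  Hence the left-hand side is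
    the sum over k of the number of words of length n over [k] having
    0 1 ... k-1 as a subsequence.

    A semistandard tableau of the conjugate of la with entries in [k] is,
    after transposition, a filling of la with strict rows and weak columns,
    which is a chain of k vertical strips from the empty shape to la; a
    standard tableau is a chain of single boxes (card_fillings).  Let g_k(la)
    be the number of the former and f^la that of the latter.  It remains to
    see that the sum of f^la * g_k(la) over the partitions la of n with first
    part k counts the words above.  The Robinson-Schensted correspondence
    would show this; here both sides are shown to obey the same recurrence.

    For a function h of shapes let D h (la) be the sum of h over the shapes
    obtained by adding a box to la, and E h (la) the sum of h over the shapes
    obtained by removing a vertical strip.  Then D E = E D + E
    (up_box_down_vstrip), so D g_k = k g_k because g_k = E^k g_0 and
    D g_0 = 0.  Cutting g_i down to the shapes whose first part is i gives F_i
    with D F_i = (i - 1) F_i + E F_(i-1) (up_box_full), and by commuting D past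
    E the functions H_i = E^(k-i) F_i satisfy D H_i = (k - 1) H_i + H_(i-1)
    for i > 0, and D H_0 = k H_0.  As the largest entry of a standard tableau
    sits in a removable box, the sum of f^la * h(la) over partitions of m + 1
    is the sum of f^la * D h (la) over partitions of m.  So the sums of
    f^la * H_i(la) over partitions of m satisfy the recurrence in m which
    distinguishing the first letter gives for the number of words of length m
    over [k] that contain a fixed word of length i as a subsequence
    (syt_sum_full_upto).  The case i = k, m = n is what is needed. *)

Set Implicit Arguments.
Unset Strict Implicit.
Unset Printing Implicit Defensive.

(** * Counting lemmas *)

Lemma sum_unique (T : finType) (P : pred T) (x : T) (b : bool) :
  (forall y, P y -> y = x /\ b) -> (b -> P x) -> \sum_y (P y : nat) = b.
Proof.
move=> Pb bP; rewrite (bigD1 x) //= big1 ?addn0; last first.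
  by move=> y /negP yx; case Py: (P y) => //; case: yx; apply/eqP; case: (Pb y).
congr nat_of_bool; apply/idP/idP => [/Pb[]|] //.
Qed.

Lemma sum_tuple_cons (T : finType) m (F : m.+1.-tuple T -> nat) :
  \sum_v F v = \sum_a \sum_(u : m.-tuple T) F [tuple of a :: u].
Proof.
rewrite pair_big /= (reindex (fun p : T * m.-tuple T => [tuple of p.1 :: p.2])) //=.
exists (fun v => (thead v, [tuple of behead v])) => [[a u] _|v _] /=.
  by rewrite theadE; congr pair; apply: val_inj.
by rewrite -tuple_eta.
Qed.

Lemma leq_ltn_imp a b : (forall j, j < a -> j < b) -> a <= b.
Proof. by move=> ab; rewrite leqNgt; apply/negP => /ab; rewrite ltnn. Qed.

Lemma card_in_bij (A B : finType) (P : {set A}) (Q : {set B}) (f : A -> B) :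
  {in P, forall a, f a \in Q} -> {in P &, injective f} ->
  (forall b, b \in Q -> exists2 a, a \in P & f a = b) -> #|P| = #|Q|.
Proof.
move=> fPQ f_inj f_onto; rewrite -(card_in_imset f_inj); congr #|pred_of_set _|.
apply/setP=> b; apply/imsetP/idP => [[a aP ->]|/f_onto[a aP <-]]; first exact: fPQ.
by exists a.
Qed.

(** * Addable and removable rows across a vertical strip *)

Section StripRows.

Variables (N : nat) (mu tau : nat -> nat).
Hypothesis mu_anti : forall i, mu i.+1 <= mu i.
Hypothesis tau_anti : forall i, tau i.+1 <= tau i.

(** Adding a box in row i of mu turns mu into a vertical strip over tau. *)
Definition strip_after (i : nat) :=
  forall j, tau j <= mu j + (j == i) <= (tau j).+1.

Definition addable (f : nat -> nat) i := (i == 0) || (f i < f i.-1).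
Definition removable (f : nat -> nat) i := f i.+1 < f i.

(** If row i of tau sticks out of mu, then it does so by the one box added, and
    the rows next to it, if any, leave room:
    mu (i-1) >= tau (i-1) >= tau i > mu i and
    tau (i+1) <= mu (i+1) <= mu i < tau i. *)
Lemma addable_removable_eq i :
  strip_after i -> ~~ (tau i <= mu i) -> addable mu i && removable tau i.
Proof.
rewrite /strip_after /addable /removable => c hi.
have ci : tau i <= mu i + 1 by have := c i; rewrite eqxx => /andP[].
have ci1 : tau i.+1 <= mu i.+1.
  by have := c i.+1; rewrite (gtn_eqF (ltnSn i)) addn0 => /andP[].
have := mu_anti i => mi; apply/andP; split; last by lia.
case: i c hi ci ci1 mi => // i c hi ci ci1 mi /=.
have := c i; rewrite (ltn_eqF (ltnSn i)) addn0 => /andP[cp _].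
by have := tau_anti i; lia.
Qed.

(** Let e i be 1 if mu i = tau i and 0 otherwise.  Going through the four values
    of (e i, e (i+1)) shows that the term of row i + 1 on the left exceeds the
    term of row i on the right by e (i+1) - e i.  The sum telescopes, and the
    surplus 1 comes from row 0, which is always addable, and from the empty
    rows far down, where e is 1. *)
Lemma sum_addable_removable :
  mu N = 0 -> tau N = 0 -> mu N.-1 = 0 -> 0 < N ->
  (forall j, tau j <= mu j <= (tau j).+1) ->
  \sum_(i < N) (addable mu i && (mu i == tau i)) =
  (\sum_(i < N) (removable tau i && (mu i == tau i))).+1.
Proof.
move=> muN tauN muN1 Ngt0 hv.
pose A (i : nat) : nat := addable mu i && (mu i == tau i).
pose B (i : nat) : nat := removable tau i && (mu i == tau i).
pose e (i : nat) : nat := mu i == tau i.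
have step i : A i.+1 + e i = B i + e i.+1.
  rewrite /A /B /e /addable /removable /=.
  have /andP[a1 a2] := hv i; have /andP[b1 b2] := hv i.+1.
  have := mu_anti i; have := tau_anti i.
  case: (ltnP (mu i.+1) (mu i)); case: (ltnP (tau i.+1) (tau i));
  case: (eqVneq (mu i.+1) (tau i.+1)); case: (eqVneq (mu i) (tau i)) => /=; lia.
(* Both sums up to m, corrected by the boundary terms of the telescoping. *)
have tele m : \sum_(i < m) A i + A m = \sum_(i < m) B i + e m.
  elim: m => [|m IH]; first by rewrite !big_ord0 /A /e /addable eqxx.
  by rewrite big_ord_recr /= IH [in RHS]big_ord_recr /= -!addnA (addnC (e m)) step.
have := tele N.
have -> : A N = 0 by rewrite /A /addable muN muN1; case: (N) Ngt0.
by rewrite /e muN tauN eqxx addn0 addn1.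
Qed.

End StripRows.

(** * Shapes and the exchange of boxes and vertical strips *)

Section Shapes.

Variable n : nat.

(** The tuples underlying intpartn n, with the size left free: partitions of all
    sizes up to n live in this one type, which makes sums over shapes of
    varying size sums over a single finite type. *)
Definition shape := n.-tuple 'I_n.+1.
Implicit Types x y z t : shape.

Definition row y i := nth 0 (map val y) i.
Definition mkshape (f : nat -> nat) : shape := [tuple inord (f i) | i < n].
Definition is_part y := sorted geq (map val y).
Definition area y := sumn (map val y).

Lemma row_le y i : row y i <= n.
Proof.
rewrite /row; case: (ltnP i n) => i_n; last by rewrite nth_default ?size_map ?size_tuple.
by rewrite (nth_map ord0) ?size_tuple // -ltnS ltn_ord.
Qed.

Lemma row_out y i : n <= i -> row y i = 0.
Proof. by move=> ni; rewrite /row nth_default ?size_map ?size_tuple. Qed.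

Lemma row_mkshape f i : i < n -> f i <= n -> row (mkshape f) i = f i.
Proof.
move=> i_n fi; rewrite /row (nth_map ord0) ?size_tuple //.
by rewrite -[i]/(val (Ordinal i_n)) -tnth_nth tnth_mktuple /= inordK.
Qed.

Lemma row_inj x y : (forall i, i < n -> row x i = row y i) -> x = y.
Proof.
move=> e; apply: val_inj; apply: (inj_map val_inj).
by apply: (@eq_from_nth _ 0); rewrite !size_map !size_tuple.
Qed.

Lemma is_partP y : reflect (forall i, row y i.+1 <= row y i) (is_part y).
Proof.
apply: (iffP (sortedP 0)) => [s i|s i _]; last exact: s.
case: (ltnP i.+1 n) => i_n; last by rewrite row_out.
by apply: s; rewrite size_map size_tuple.
Qed.

Lemma row_anti y i j : is_part y -> i <= j -> row y j <= row y i.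
Proof.
move=> /is_partP s /subnK <-; elim: (j - i) => // k IH.
by rewrite addSn (leq_trans (s _)).
Qed.

Lemma areaE y : area y = \sum_(i < n) row y i.
Proof. by rewrite /area sumnE (big_nth 0) size_map size_tuple big_mkord. Qed.

(** Rows 0, ..., i are at least as long as row i.  Hence an area below n leaves
    the last of the n rows empty, and a box can be added without leaving the
    n x n square. *)
Lemma leq_area_row y i : is_part y -> row y i * i.+1 <= area y.
Proof.
move=> yP; case: (ltnP i n) => i_n; last by rewrite row_out.
rewrite areaE -(big_mkord xpredT (row y)) (big_cat_nat (n := i.+1)) //=.
apply: leq_trans (leq_addr _ _).
rewrite mulnC -{1}[i.+1]subn0 -sum_nat_const_nat.
rewrite big_nat_cond [X in _ <= X]big_nat_cond.
by apply: leq_sum => j /andP[/andP[_ ji] _]; apply: row_anti.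
Qed.

Definition vstrip x y :=
  [&& is_part x, is_part y & [forall i : 'I_n, row x i <= row y i <= (row x i).+1]].

Definition box_at (i : 'I_n) x y :=
  [&& is_part x, is_part y & [forall j : 'I_n, row y j == row x j + (j == i)]].

Definition box x y := [exists i, box_at i x y].

Lemma vstripP x y : reflect
  [/\ is_part x, is_part y & forall i, row x i <= row y i <= (row x i).+1]
  (vstrip x y).
Proof.
apply: (iffP and3P) => -[xP yP h]; split=> //; last by apply/forallP=> i.
move=> i; case: (ltnP i n) => i_n; last by rewrite !row_out.
exact: (forallP h (Ordinal i_n)).
Qed.

Lemma box_atP (i : 'I_n) x y : reflect
  [/\ is_part x, is_part y & forall j, row y j = row x j + (j == i :> nat)]
  (box_at i x y).
Proof.
apply: (iffP and3P) => -[xP yP h]; split=> //; last first.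
  by apply/forallP=> j; rewrite h.
move=> j; case: (ltnP j n) => j_n; last first.
  by rewrite !row_out // gtn_eqF // (leq_trans _ j_n).
by rewrite (eqP (forallP h (Ordinal j_n))).
Qed.

(** A step by one box determines the row of that box; this turns sums over boxes
    into sums over rows. *)
Lemma box_sum x y : box x y = \sum_i box_at i x y :> nat.
Proof.
case: (boolP (box x y)) => [/existsP[i xy]|/existsPn no]; last first.
  by rewrite big1 // => i _; rewrite (negPf (no i)).
apply/esym/(@sum_unique _ _ i true) => // j /box_atP[_ _ h]; split=> //.
case/box_atP: xy => _ _ /(_ j); rewrite h eqxx => /addnI.
by case: eqP => // /val_inj.
Qed.

Lemma box_area x y : box x y -> area y = (area x).+1.
Proof.
case/existsP=> i /box_atP[_ _ h]; rewrite !areaE; under eq_bigr do rewrite h.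
rewrite big_split /= -[in RHS]addn1; congr (_ + _).
by apply: (@sum_unique _ (fun j => j == i) i true) => [j /eqP|].
Qed.

Lemma vstrip_area x y : vstrip x y -> area x <= area y.
Proof. by case/vstripP=> _ _ h; rewrite !areaE leq_sum // => i _; case/andP: (h i). Qed.

Definition strip_afterb x t (i : 'I_n) :=
  [forall j : 'I_n, row t j <= row x j + (j == i) <= (row t j).+1].

Section Exchange.

Variables x t : shape.
Hypotheses (xP : is_part x) (tP : is_part t) (xn : area x < n).

Lemma strip_afterP (i : 'I_n) :
  reflect (strip_after (row x) (row t) i) (strip_afterb x t i).
Proof.
apply: (iffP forallP) => h j; last exact: h.
case: (ltnP j n) => j_n; first exact: h (Ordinal j_n).
by rewrite !row_out // gtn_eqF // (leq_trans _ j_n).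
Qed.

Lemma row_small i : i.+1 >= n -> row x i = 0.
Proof. by move=> ni; have := leq_area_row i xP; case: (row x i) => // r; lia. Qed.

Lemma row_ltn i : row x i < n.
Proof. have := leq_area_row i xP; lia. Qed.

Lemma sum_box_vstrip i :
  \sum_y (box_at i x y && vstrip t y) = addable (row x) i && strip_afterb x t i.
Proof.
pose f j := row x j + (j == i).
have fE j : row (mkshape f) j = f j.
  case: (ltnP j n) => j_n; last first.
    by rewrite row_out // /f row_out // gtn_eqF // (leq_trans _ j_n).
  by apply: row_mkshape => //; have := row_ltn j; rewrite /f; case: eqP; lia.
apply: (@sum_unique _ _ (mkshape f)) => [y /andP[/box_atP[_ yP h] /vstripP[_ _ v]]|].
  split; first by apply: row_inj => j _; rewrite fE h.
  apply/andP; split; last by apply/strip_afterP=> j; rewrite -h.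
  rewrite /addable; case: eqP => //= i0.
  have := row_anti yP (leq_pred i); rewrite !h eqxx.
  by rewrite ltn_eqF; lia.
case/andP=> ai /strip_afterP ci.
have fP : is_part (mkshape f).
  apply/is_partP=> j; rewrite !fE /f; have := row_anti xP (leqnSn j).
  case: (eqVneq j.+1 i) => [ji|]; last by lia.
  by move: ai; rewrite /addable -ji /=; lia.
by apply/andP; split; [apply/box_atP|apply/vstripP]; split=> // j; rewrite fE.
Qed.

Lemma sum_vstrip_box i :
  \sum_z (box_at i z t && vstrip z x) = removable (row t) i && strip_afterb x t i.
Proof.
pose f j := row t j - (j == i).
have fE j : row (mkshape f) j = f j.
  case: (ltnP j n) => j_n; last by rewrite row_out // /f row_out.
  by apply: row_mkshape => //; have := row_le t j; rewrite /f; lia.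
apply: (@sum_unique _ _ (mkshape f)) => [z /andP[/box_atP[zP _ h] /vstripP[_ _ v]]|].
  split; first by apply: row_inj => j _; rewrite fE /f h addnK.
  apply/andP; split; last by apply/strip_afterP=> j; have := v j; rewrite h; lia.
  by rewrite /removable !h eqxx gtn_eqF // addn0 addn1 ltnS row_anti.
case/andP=> ri /strip_afterP ci.
have fP : is_part (mkshape f).
  apply/is_partP=> j; rewrite !fE /f; have := row_anti tP (leqnSn j).
  case: (eqVneq j i) => [ji|]; last by lia.
  by move: ri; rewrite /removable -ji /=; lia.
apply/andP; split.
  apply/box_atP; split=> // j; rewrite fE /f; case: (eqVneq j i) => [->|]; last by lia.
  by move: ri; rewrite /removable; lia.
apply/vstripP; split=> // j; rewrite fE /f; have := ci j.
case: (eqVneq j i) => [->|]; last by lia.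
by move: ri; rewrite /removable; lia.
Qed.

End Exchange.

(** Both sums range over the rows i where x with a box added in row i is a
    vertical strip over t; on the left the row must be addable in x, on the
    right removable in t.  If x is not itself a vertical strip over t, the two
    conditions hold together; if it is, the numbers of rows differ by one. *)
Lemma box_vstrip_exchange x t : area x < n ->
  \sum_y (box x y && vstrip t y) = \sum_z (box z t && vstrip z x) + vstrip t x.
Proof.
move=> xn.
have [xP|xP] := boolP (is_part x); last first.
  rewrite !big1 => [|z _|y _].
  - by case: vstripP => // -[_]; rewrite (negPf xP).
  - by case: vstripP => [[_]|]; rewrite ?andbF // (negPf xP).
  by case bx: (box x y) => //; case/existsP: bx => i /box_atP[]; rewrite (negPf xP).
have [tP|tP] := boolP (is_part t); last first.
  rewrite !big1 => [|z _|y _].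
  - by case: vstripP => // -[]; rewrite (negPf tP).
  - by case bx: (box z t) => //; case/existsP: bx => i /box_atP[_]; rewrite (negPf tP).
  by case: vstripP => [[]|]; rewrite ?andbF // (negPf tP).
have mul (a b : bool) : a && b = a * b :> nat by case: a; case: b.
have -> : \sum_y (box x y && vstrip t y) =
          \sum_i \sum_y (box_at i x y && vstrip t y).
  rewrite exchange_big /=; apply: eq_bigr => y _.
  by rewrite mul box_sum big_distrl /=; apply: eq_bigr => i _; rewrite mul.
have -> : \sum_z (box z t && vstrip z x) =
          \sum_i \sum_z (box_at i z t && vstrip z x).
  rewrite exchange_big /=; apply: eq_bigr => y _.
  by rewrite mul box_sum big_distrl /=; apply: eq_bigr => i _; rewrite mul.
under eq_bigr => i _ do rewrite sum_box_vstrip //.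
under [in RHS]eq_bigr => i _ do rewrite sum_vstrip_box //.
have xA := is_partP _ xP; have tA := is_partP _ tP.
have [tx|tx] := boolP (vstrip t x); last first.
  rewrite addn0; apply: eq_bigr => i _; case: strip_afterP => [c|]; last by rewrite !andbF.
  rewrite !andbT; have [le|nle] := boolP (row t i <= row x i); last first.
    by have /andP[-> ->] := addable_removable_eq xA tA c nle.
  case/negP: tx; apply/vstripP; split=> // j.
  have := c j; case: (eqVneq j i) => [->|_]; last by rewrite addn0.
  by rewrite le /= addn1; case/andP=> _ /ltnW.
case/vstripP: tx => _ _ tx.
have condE i : strip_afterb x t i = (row x i == row t i).
  apply/strip_afterP/eqP => [c|e j].
    by have := c i; have := tx i; rewrite eqxx; lia.
  by have := tx j; case: (eqVneq j i) => [->|]; rewrite ?e; lia.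
under eq_bigr => i _ do rewrite condE.
under [in RHS]eq_bigr => i _ do rewrite condE.
rewrite addn1; apply: sum_addable_removable => //; first by rewrite row_out.
- by rewrite row_out.
- by apply: row_small => //; lia.
by lia.
Qed.

End Shapes.

(** * Linear operators on functions of shapes *)

Section Operators.

Variable n : nat.
Implicit Types (x y z t : shape n) (f g : shape n -> nat).

Definition down (R : rel (shape n)) f y := \sum_(x | R x y) f x.
Definition up_box f x := \sum_(y | box x y) f y.
Definition empty_ind y : nat := area y == 0.
Definition chains R k := iter k (down R) empty_ind.

Lemma leq_row_area y i : row y i <= area y.
Proof.
case: (ltnP i n) => i_n; last by rewrite row_out.
by rewrite areaE (bigD1 (Ordinal i_n)) //= leq_addr.
Qed.

Lemma box_part x y : box x y -> is_part x /\ is_part y.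
Proof. by case/existsP => i /box_atP[]. Qed.

Lemma box_row0 x y : box x y -> row x 0 <= row y 0 <= (row x 0).+1.
Proof. by case/existsP => i /box_atP[_ _ h]; rewrite h; case: eqP; lia. Qed.

Lemma eq_down f g x :
  (forall z, area z <= area x -> f z = g z) ->
  down (@vstrip n) f x = down (@vstrip n) g x.
Proof. by move=> fg; apply: eq_bigr => z /vstrip_area; apply: fg. Qed.

(** The relation D E = E D + E: the coefficients of each value f t on both sides
    are compared by box_vstrip_exchange. *)
Lemma up_box_down_vstrip f x : area x < n ->
  up_box (down (@vstrip n) f) x =
  down (@vstrip n) (up_box f) x + down (@vstrip n) f x.
Proof.
move=> xn; rewrite /up_box /down.
have flat (P : pred (shape n)) (Q : rel (shape n)) :
    \sum_(y | P y) \sum_(t | Q y t) f t =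
    \sum_t (\sum_y (P y && Q y t)) * f t.
  rewrite (eq_bigr (fun y => \sum_t Q y t * f t)) => [|y _]; last first.
    by rewrite big_mkcond; apply: eq_bigr => t _; case: ifP; rewrite ?mul1n.
  rewrite exchange_big /=; apply: eq_bigr => t _.
  rewrite big_mkcond big_distrl; apply: eq_bigr => y _.
  by case: (P y).
rewrite !flat [X in _ = _ + X]big_mkcond -big_split /=.
apply: eq_bigr => t _; rewrite box_vstrip_exchange // mulnDl; congr (_ + _).
  by congr (_ * _); apply: eq_bigr => z _; rewrite andbC.
by case: ifP; rewrite ?mul1n.
Qed.

Notation E := (down (@vstrip n)).
Notation rowstrict := (chains (@vstrip n)).

Lemma up_box_empty x : up_box empty_ind x = 0.
Proof. by rewrite /up_box big1 // => y /box_area; rewrite /empty_ind => ->. Qed.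

Lemma up_box_rowstrict k x : area x < n ->
  up_box (rowstrict k) x = k * rowstrict k x.
Proof.
elim: k x => [|k IH] x xn; first exact: up_box_empty.
rewrite /= up_box_down_vstrip //.
rewrite (@eq_down _ (fun z => k * rowstrict k z)) => [|z zx]; last first.
  by rewrite IH // (leq_ltn_trans zx).
by rewrite /down -big_distrr /= mulSn addnC.
Qed.

(** A vertical strip adds at most one box to the first row. *)
Lemma rowstrict_row0 k y : k < row y 0 -> rowstrict k y = 0.
Proof.
elim: k y => [|k IH] y ky.
  by rewrite /= /empty_ind; have := leq_row_area y 0; case: eqP; lia.
rewrite /= /down big1 // => x /vstripP[_ _ v]; apply: IH.
by have := v 0; lia.
Qed.

(** As rowstrict i vanishes on the shapes with a first row longer than i, only
    those with a first row of length exactly i contribute; on tableaux, the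
    first row reads 0, 1, ..., i - 1. *)
Definition full i y := (i <= row y 0) * rowstrict i y.

(** If the first row of x has length at least i + 1, the restrictions on the
    first row are void and this is up_box_rowstrict.  If it has length i, only
    the box in row 0 counts, and the last vertical strip of the enlarged shape
    must then contain that box.  If it is shorter, everything vanishes. *)
Lemma up_box_full i x : area x < n ->
  up_box (full i.+1) x = i * full i.+1 x + E (full i) x.
Proof.
move=> xn; have n_gt0 : 0 < n by lia.
have [xP|xP] := boolP (is_part x); last first.
  rewrite /full /= /down [X in i * (_ * X)]big1 => [|z]; last first.
    by case/vstripP=> _; rewrite (negPf xP).
  rewrite !muln0 /up_box !big1 // => [z /vstripP[_]|y /box_part[]].
    by rewrite (negPf xP).
  by rewrite (negPf xP).
case: (ltngtP (row x 0) i) => [xi|xi|xi].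
- rewrite /full leqNgt ltnS ltnW //= mul0n muln0 /up_box /down !big1 //.
    by move=> z /vstripP[_ _ /(_ 0) v]; rewrite leqNgt (_ : _ < i) //; lia.
  by move=> y /box_row0 h; rewrite leqNgt (_ : _ < i.+1) //; lia.
- rewrite /full xi mul1n /up_box.
  rewrite (eq_bigr (rowstrict i.+1)) => [|y /box_row0 h]; last first.
    by rewrite (_ : i.+1 <= row y 0) ?mul1n //; lia.
  rewrite -/(up_box _ _) up_box_rowstrict // mulSn addnC; congr (_ + _).
  apply: eq_bigr => z /vstripP[_ _ /(_ 0) v].
  by rewrite (_ : i <= row z 0) ?mul1n //; lia.
(* Only a box in row 0 can make the first row of length i + 1. *)
pose f0 j := row x j + (j == 0); have ff0 j : f0 j = row x j + (j == 0) by [].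
have fE j : row (mkshape n f0) j = f0 j.
  case: (ltnP j n) => j_n; last by rewrite row_out // ff0 row_out // gtn_eqF // (leq_trans n_gt0).
  by apply: row_mkshape => //; have := leq_row_area x j; rewrite ff0; case: eqP; lia.
set y0 := mkshape n f0 in fE.
have y0P : is_part y0.
  apply/is_partP=> j; rewrite !fE !ff0 addn0.
  by rewrite (leq_trans (row_anti xP (leqnSn j))) ?leq_addr.
have bxy0 : box x y0.
  by apply/existsP; exists (Ordinal n_gt0); apply/box_atP; split=> // j; rewrite fE.
rewrite /full leqNgt ltnS xi leqnn /= mul0n muln0 add0n /up_box.
rewrite (bigD1 y0) //= big1 ?addn0 => [|y /andP[/existsP[j /box_atP[_ _ h]] ne]]; last first.
  rewrite leqNgt (_ : row y 0 < i.+1) // h; case: eqP => j0; last by lia.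
  by case/eqP: ne; apply: row_inj => l _; rewrite fE ff0 h j0.
rewrite fE ff0 xi addn1 ltnSn mul1n /down big_mkcond [RHS]big_mkcond /=.
apply: eq_bigr => z _; case: (ltnP i (row z 0)) => [zi|zi].
  by rewrite rowstrict_row0 // muln0; do 2![case: ifP].
case: vstripP => [[zP _ v]|vN].
  have e0 : row z 0 = i by have := v 0; rewrite fE ff0 xi eqxx; lia.
  case: vstripP => [_|[]]; first by rewrite e0 leqnn mul1n.
  split=> // j; have := v j; rewrite fE ff0.
  by case: (eqVneq j 0) => [->|_]; [rewrite e0 xi; lia | rewrite addn0].
case: vstripP => // -[zP _ v]; case: (leqP i (row z 0)) => // iz.
case: vN; split=> // j; have := v j; rewrite fE ff0.
by case: (eqVneq j 0) => [->|_]; [rewrite xi; lia | rewrite addn0].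
Qed.

(** Counts the fillings by i + m values, with strict rows and weak columns, whose
    first row starts with 0, 1, ..., i - 1. *)
Definition full_upto i m := iter m E (full i).

Lemma up_box_full_upto i m x : area x < n ->
  up_box (full_upto i.+1 m) x =
  (i + m) * full_upto i.+1 m x + full_upto i m.+1 x.
Proof.
elim: m x => [|m IH] x xn; first by rewrite addn0; apply: up_box_full.
rewrite /= up_box_down_vstrip //.
rewrite (@eq_down _ (fun z => (i + m) * full_upto i.+1 m z + full_upto i m.+1 z)).
  by rewrite /down big_split -big_distrr /= -!/(down _ _ _) addnS mulSn; lia.
by move=> z zx; rewrite IH // (leq_ltn_trans zx).
Qed.

Lemma full_upto0 m : full_upto 0 m =1 rowstrict m.
Proof.
by elim: m => [|m IH] y; [rewrite /= /full mul1n | apply: eq_bigr => x _; exact: IH].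
Qed.

Lemma eq_up_box f g : f =1 g -> up_box f =1 up_box g.
Proof. by move=> fg x; apply: eq_bigr => y _. Qed.

(** The sum of f^y * f y over the partitions y of m, as chains of m boxes end in
    shapes of area m only. *)
Definition syt_sum m f := \sum_y chains (@box n) m y * f y.

Lemma syt_sumS m f : syt_sum m.+1 f = syt_sum m (up_box f).
Proof.
rewrite /syt_sum /= /down /up_box.
under eq_bigr do rewrite big_distrl /=.
under [in RHS]eq_bigr do rewrite big_distrr /=.
by rewrite (exchange_big_dep xpredT).
Qed.

Lemma chains_box_area m y : chains (@box n) m y != 0 -> area y = m.
Proof.
elim: m y => [|m IH] y; first by rewrite /= /empty_ind eqb0 negbK => /eqP.
rewrite /= /down sum_nat_eq0 negb_forall => /existsP[x]; rewrite negb_imply.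
by case/andP => xy /IH <-; apply: box_area.
Qed.

Lemma eq_syt_sum m f g : (forall y, area y = m -> f y = g y) ->
  syt_sum m f = syt_sum m g.
Proof.
move=> fg; apply: eq_bigr => y _.
have [->//|/chains_box_area ym] := eqVneq (chains (@box n) m y) 0.
by rewrite fg.
Qed.

Definition shape0 : shape n := mkshape n (fun=> 0).

Lemma row_shape0 i : row shape0 i = 0.
Proof. by case: (ltnP i n) => i_n; [rewrite row_mkshape | rewrite row_out]. Qed.

Lemma area_eq0 y : (area y == 0) = (y == shape0).
Proof.
apply/eqP/eqP => [y0|->]; last by rewrite areaE big1 // => i _; rewrite row_shape0.
by apply: row_inj => i _; rewrite row_shape0; have := leq_row_area y i; lia.
Qed.

Lemma syt_sum0 f : syt_sum 0 f = f shape0.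
Proof.
rewrite /syt_sum (bigD1 shape0) //= big1 => [|y /negPf y0].
  by rewrite /empty_ind area_eq0 eqxx mul1n addn0.
by rewrite /empty_ind area_eq0 y0.
Qed.

Lemma is_part0 : is_part shape0.
Proof. by apply/is_partP=> i; rewrite !row_shape0. Qed.

Lemma down_vstrip_shape0 f : E f shape0 = f shape0.
Proof.
rewrite /down (big_pred1 shape0) // => x; apply/vstripP/eqP => [[_ _ v]|->].
  by apply: row_inj => i _; have := v i; rewrite row_shape0; lia.
by split=> [||i]; rewrite ?is_part0 ?row_shape0.
Qed.

Lemma full_upto_shape0 i m : full_upto i m shape0 = (i == 0).
Proof.
elim: m => [|m IH]; last by rewrite /= down_vstrip_shape0.
rewrite /= /full row_shape0 leqn0; case: eqP => // ->.
by rewrite /= /empty_ind area_eq0 eqxx.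
Qed.

End Operators.

(** * Words containing a given subsequence *)

Definition num_words m (k : nat) (s : seq 'I_k) :=
  #|[set v : m.-tuple 'I_k | subseq s v]|.

Lemma num_wordsE m k (s : seq 'I_k) :
  num_words m s = \sum_(v : m.-tuple 'I_k) subseq s v.
Proof. by rewrite /num_words cardsE -sum1_card big_mkcond. Qed.

Lemma num_words0 k (s : seq 'I_k) : num_words 0 s = (s == [::]).
Proof.
rewrite num_wordsE (eq_bigr (fun=> nat_of_bool (s == [::]))) => [|v _].
  by rewrite sum_nat_const card_tuple expn0 mul1n.
by rewrite tuple0 subseq0.
Qed.

Lemma num_words_nil m k :
  num_words m.+1 ([::] : seq 'I_k) = k * num_words m ([::] : seq 'I_k).
Proof.
rewrite !num_wordsE sum_tuple_cons /= sum_nat_const card_ord; congr (_ * _).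
by apply: eq_bigr => u _; rewrite !sub0seq.
Qed.

(** If the first letter of v is a, it may be matched with the a of a :: s, and
    s has to occur in the rest; any other first letter is useless. *)
Lemma num_words_cons m k (a : 'I_k) s :
  num_words m.+1 (a :: s) = k.-1 * num_words m (a :: s) + num_words m s.
Proof.
rewrite !num_wordsE sum_tuple_cons (bigD1 a) //= addnC; congr (_ + _); last first.
  by apply: eq_bigr => u _; rewrite eqxx.
rewrite (eq_bigr (fun=> \sum_(u : m.-tuple 'I_k) subseq (a :: s) u)).
  by rewrite sum_nat_const cardC1 card_ord.
by move=> b /negPf ba; apply: eq_bigr => u _; rewrite eq_sym ba.
Qed.

(** Both sides obey the same recurrence in m.  The bound m <= n keeps the shapes
    of area below n, where D and E satisfy their exchange relation. *)
Lemma syt_sum_full_upto n k m (s : seq 'I_k) : m <= n -> size s <= k ->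
  syt_sum m (@full_upto n (size s) (k - size s)) = num_words m s.
Proof.
elim: m s => [|m IH] s mn sk.
  by rewrite syt_sum0 full_upto_shape0 num_words0 size_eq0.
have lin c f g : @syt_sum n m (fun y => c * f y + g y) =
                 c * syt_sum m f + syt_sum m g.
  rewrite /syt_sum big_distrr -big_split /=; apply: eq_bigr => y _.
  by rewrite mulnDr mulnCA.
rewrite syt_sumS; case: s sk => [|a s] sk.
  rewrite num_words_nil -(IH _ (ltnW mn)) //= subn0.
  have z0 : @syt_sum n m (fun=> 0) = 0.
    by rewrite /syt_sum big1 // => y _; rewrite muln0.
  rewrite -[RHS]addn0 -[X in _ = _ + X]z0 -lin; apply: eq_syt_sum => y ym.
  rewrite (eq_up_box (@full_upto0 n k)) up_box_rowstrict ?ym //.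
  by rewrite addn0 full_upto0.
rewrite num_words_cons -!(IH _ (ltnW mn)) ?(ltnW sk) // -lin.
apply: eq_syt_sum => y ym; rewrite [size (a :: s)]/= up_box_full_upto ?ym //.
by rewrite subnSK //; congr (_ * _ + _); move: sk => /=; lia.
Qed.

(** * Tableaux as chains of shapes *)

Section ChainCount.

Variables (n : nat) (R : rel (shape n)).

Definition rev_rel : rel (shape n) := fun a b => R b a.

(** The tuples list the chain from y downwards, so that their head is the step
    that the outermost operator down sums over. *)
Lemma chainsE k y :
  chains R k y =
  #|[set t : k.-tuple (shape n) | path rev_rel y t && (last y t == shape0 n)]|.
Proof.
rewrite cardsE -sum1_card big_mkcond.
rewrite (eq_bigr (fun t : k.-tuple (shape n) =>
   nat_of_bool (path rev_rel y t && (last y t == shape0 n)))) //.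
elim: k y => [|k IH] y.
  rewrite (eq_bigr (fun=> nat_of_bool (y == shape0 n))) => [|t _].
    by rewrite sum_nat_const card_tuple expn0 mul1n /= /empty_ind area_eq0.
  by rewrite tuple0.
rewrite sum_tuple_cons /= /down [LHS]big_mkcond; apply: eq_bigr => x _.
rewrite /rev_rel -/(rev_rel); case: (R x y) => /=; last by rewrite big1.
exact: IH.
Qed.

End ChainCount.

(** The cells are an abstract set with a row r and a column c, so that the cells
    of a shape and, with r and c swapped, those of its conjugate are instances. *)
Section Fillings.

Variables (n k : nat) (cells : finType) (r c : cells -> nat) (y : shape n).
Hypothesis yP : is_part y.
Hypothesis rc_inj : forall a b, r a = r b -> c a = c b -> a = b.
Hypothesis rc_in : forall a, c a < row y (r a).
Hypothesis rc_onto : forall i j, j < row y i -> exists a, r a = i /\ c a = j.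

Implicit Types (T : {ffun cells -> 'I_k}) (L : nat -> shape n).

Definition row_weak T := forall a b, r a = r b -> c a < c b -> T a <= T b.
Definition row_strict T := forall a b, r a = r b -> c a < c b -> T a < T b.
Definition col_weak T := forall a b, c a = c b -> r a < r b -> T a <= T b.
Definition col_strict T := forall a b, c a = c b -> r a < r b -> T a < T b.

(** L v is the subshape of the cells whose value is below v.  Nothing is said
    about L beyond k. *)
Definition is_levels T L := forall v, v <= k ->
  [/\ is_part (L v), forall i, row (L v) i <= row y i &
      forall a, (T a < v) = (c a < row (L v) (r a))].

(** A place (i, j) without a cell satisfies the condition, as if it held an
    infinite value. *)
Definition level_row T v i :=
  find (fun j => [forall a, (r a == i) && (c a == j) ==> (v <= T a)]) (iota 0 n).

Definition level T v : shape n := mkshape n (level_row T v).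

Lemma row_lt_n a : r a < n.
Proof. by rewrite ltnNge; apply/negP=> /row_out e; have := rc_in a; rewrite e. Qed.

Lemma row_level T v i : row (level T v) i = if i < n then level_row T v i else 0.
Proof.
case: ifP => i_n; last by rewrite row_out // leqNgt i_n.
by rewrite row_mkshape // /level_row (leq_trans (find_size _ _)) ?size_iota.
Qed.

Lemma level_inv T v i j : j < row (level T v) i ->
  exists a, [/\ r a = i, c a = j & T a < v].
Proof.
rewrite row_level; case: ifP => // i_n jl.
have j_n : j < n by rewrite (leq_trans jl) // (leq_trans (find_size _ _)) ?size_iota.
have := before_find 0 jl; rewrite nth_iota // add0n => /forallPn[a].
by rewrite negb_imply -ltnNge => /andP[/andP[/eqP ra /eqP ca] av]; exists a.
Qed.

(** Along a weakly increasing row the values below v form an initial segment, so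
    it is enough to look for the first value that is at least v. *)
Lemma level_cell T v a : row_weak T -> (T a < v) = (c a < row (level T v) (r a)).
Proof.
move=> Tw; apply/idP/idP => [av|/level_inv[b [rb cb]]]; last first.
  by rewrite (rc_inj rb cb).
rewrite row_level row_lt_n ltnNge; apply/negP; set q := level_row _ _ _ => qc.
have qn : q < n by rewrite (leq_trans (leq_ltn_trans qc (rc_in a))) ?row_le.
have := @nth_find _ 0 (fun j => [forall b, (r b == r a) && (c b == j) ==> (v <= T b)])
  (iota 0 n).
rewrite has_find size_iota -/(level_row T v (r a)) -/q nth_iota // add0n => /(_ qn).
have [b [rb cb]] := rc_onto (leq_ltn_trans qc (rc_in a)).
move=> /forallP/(_ b); rewrite rb cb !eqxx /= => vb.
have : T b <= T a.
  move: qc; rewrite leq_eqVlt => /orP[/eqP e|qc]; last by apply: Tw; rewrite ?cb.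
  by rewrite (rc_inj rb) // cb.
by lia.
Qed.

Lemma is_levels_level T : row_weak T -> col_weak T -> is_levels T (level T).
Proof.
move=> Tr Tc v vk; split=> [|i|a]; last exact: level_cell.
  apply/is_partP=> i; apply: leq_ltn_imp => j /level_inv[a [ra ca av]].
  have [b [rb cb]] : exists b, r b = i /\ c b = j.
    by apply: rc_onto; rewrite -ca (leq_trans (rc_in a)) // ra row_anti.
  rewrite -rb -cb -level_cell //; apply: leq_ltn_trans av.
  by apply: Tc; rewrite ?cb // rb ra.
by apply: leq_ltn_imp => j /level_inv[a [<- <- _]].
Qed.

Lemma is_levels_uniq T L L' v : is_levels T L -> is_levels T L' -> v <= k -> L v = L' v.
Proof.
move=> TL TL' vk; have [_ Ly La] := TL v vk; have [_ Ly' La'] := TL' v vk.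
apply: row_inj => i _; apply/eqP; rewrite eqn_leq.
apply/andP; split; apply: leq_ltn_imp => j ji.
  have [a [ra ca]] := rc_onto (leq_trans ji (Ly i)).
  by rewrite -ca -ra -La' La ra ca.
have [a [ra ca]] := rc_onto (leq_trans ji (Ly' i)).
by rewrite -ca -ra -La La' ra ca.
Qed.

Lemma levels_top T L : is_levels T L -> L k = y.
Proof.
move=> TL; have [_ Ly La] := TL k (leqnn k).
apply: row_inj => i _; apply/eqP; rewrite eqn_leq Ly /=.
by apply: leq_ltn_imp => j /rc_onto[a [<- <-]]; rewrite -La.
Qed.

Lemma levels_bottom T L : is_levels T L -> L 0 = shape0 n.
Proof.
move=> TL; have [_ Ly La] := TL 0 (leq0n k).
apply: row_inj => i _; rewrite row_shape0; apply/eqP; rewrite -leqn0.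
apply: leq_ltn_imp => j ji; have [a [ra ca]] := rc_onto (leq_trans ji (Ly i)).
by move: ji; rewrite -ra -ca -La.
Qed.

Lemma levels_fun T T' L : is_levels T L -> is_levels T' L -> T = T'.
Proof.
move=> TL TL'; apply/ffunP=> a; apply: val_inj; apply/eqP; rewrite eqn_leq.
have [_ _ h1] := TL (T' a).+1 (ltn_ord _); have [_ _ h1'] := TL' (T' a).+1 (ltn_ord _).
have [_ _ h2] := TL (T a).+1 (ltn_ord _); have [_ _ h2'] := TL' (T a).+1 (ltn_ord _).
by apply/andP; split; rewrite -ltnS ?h1 -?h1' ?h2' -?h2.
Qed.

Lemma levels_row_weak T L : is_levels T L -> row_weak T.
Proof.
move=> TL a b rab cab; have [_ _ h] := TL (T b).+1 (ltn_ord _).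
by rewrite -ltnS h rab (ltn_trans cab) // -h ltnSn.
Qed.

Lemma levels_col_weak T L : is_levels T L -> col_weak T.
Proof.
move=> TL a b cab rab; have [Lp _ h] := TL (T b).+1 (ltn_ord _).
by rewrite -ltnS h cab (leq_trans _ (row_anti Lp (ltnW rab))) // -h ltnSn.
Qed.

(** The value of a cell is the last v such that L v does not yet contain it. *)
Lemma levels_ex L : L 0 = shape0 n -> L k = y ->
  (forall v, v <= k -> is_part (L v)) ->
  (forall v, v < k -> forall i, row (L v) i <= row (L v.+1) i) ->
  exists T, is_levels T L.
Proof.
move=> L0 Lk Lp Li.
have Lmono u v i : u <= v -> v <= k -> row (L u) i <= row (L v) i.
  move=> /subnK <-; elim: (v - u) => // d IH; rewrite addSn => dk.
  by rewrite (leq_trans (IH _)) ?Li // ltnW.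
have cell_ex a : exists v : 'I_k, forall u, u <= k ->
    (v < u) = (c a < row (L u) (r a)).
  have ex : exists u, (u <= k) && (c a < row (L u) (r a)).
    by exists k; rewrite leqnn Lk rc_in.
  case: (ex_minnP ex) => -[|v]; first by rewrite L0 row_shape0 ltn0 andbF.
  case/andP=> vk cv vmin; exists (Ordinal vk) => u uk /=.
  apply/idP/idP => [vu|cu]; first by rewrite (leq_trans cv) ?Lmono.
  by apply: vmin; rewrite uk.
have [f fP] := fin_all_exists cell_ex.
exists [ffun a => f a] => v vk; split; first exact: Lp.
- by move=> i; rewrite -Lk Lmono.
by move=> a; rewrite ffunE fP.
Qed.

(** A filling that increases weakly along rows and columns is the same as the
    chain of its levels; the hypothesis on A says that membership can be read
    off the successive steps of that chain. *)
Lemma card_fillings (A : {set {ffun cells -> 'I_k}}) (R : rel (shape n)) :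
  (forall T, T \in A -> row_weak T /\ col_weak T) ->
  (forall x z, R x z -> [/\ is_part x, is_part z & forall i, row x i <= row z i]) ->
  (forall T L, is_levels T L ->
     (T \in A <-> forall v, v < k -> R (L v) (L v.+1))) ->
  #|A| = chains R k y.
Proof.
move=> Aw Rinc AR; rewrite chainsE.
pose f T : k.-tuple (shape n) := [tuple level T (k - j.+1) | j < k].
have fA T : T \in A -> is_levels T (level T).
  by case/Aw; apply: is_levels_level.
have nth_f T v : T \in A -> v <= k -> nth y (y :: f T) (k - v) = level T v.
  move=> TA; rewrite leq_eqVlt => /orP[/eqP->|vk].
    by rewrite subnn (levels_top (fA T TA)).
  have jk : k - v.+1 < k by lia.
  rewrite -(subnSK vk) -[LHS]/(nth y (f T) (val (Ordinal jk))) -tnth_nth.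
  by rewrite tnth_mktuple; congr level; rewrite /=; lia.
have pathE (t : k.-tuple (shape n)) :
    reflect (forall v, v < k -> R (nth y (y :: t) (k - v)) (nth y (y :: t) (k - v.+1)))
      (path (rev_rel R) y t).
  apply: (iffP (pathP y)); rewrite size_tuple => h v vk.
    have jk : k - v.+1 < k by lia.
    by have := h _ jk; rewrite /rev_rel -(@subnSK v k).
  have jk : k - v.+1 < k by lia.
  by have := h _ jk; rewrite (subnSK vk) (subKn vk) (subKn (ltnW vk)).
have lastE (t : k.-tuple (shape n)) : last y t = nth y (y :: t) (k - 0).
  by rewrite (last_nth y) size_tuple subn0.
apply: (card_in_bij (f := f)) => [T TA|T T' TA TA' ff|t].
- rewrite inE lastE nth_f // (levels_bottom (fA T TA)) eqxx andbT.
  by apply/pathE => v vk; rewrite !nth_f ?(ltnW vk) //; apply: (proj1 (AR _ _ (fA T TA))).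
- apply: (@levels_fun _ _ (level T)); first exact: fA.
  move=> v vk; rewrite -nth_f // ff nth_f //; exact: fA.
rewrite inE lastE => /andP[/pathE tR /eqP t0].
pose L v := nth y (y :: t) (k - v).
have [||v vk||T TL] := @levels_ex L.
- exact: t0.
- by rewrite /L subnn.
- move: vk; rewrite leq_eqVlt => /orP[/eqP->|vk]; first by rewrite /L subnn.
  by case: (Rinc _ _ (tR v vk)).
- by move=> v vk; case: (Rinc _ _ (tR v vk)).
have TA : T \in A by exact: (proj2 (AR _ _ TL)).
exists T => //; apply: eq_from_tnth => j; rewrite tnth_mktuple.
rewrite (is_levels_uniq (fA T TA) TL) ?leq_subr // /L subKn ?ltn_ord //=.
by rewrite (tnth_nth y).
Qed.

Lemma levels_leq T L v : is_levels T L -> v < k -> forall i, row (L v) i <= row (L v.+1) i.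
Proof.
move=> TL vk i; have [_ Ly h] := TL v (ltnW vk); have [_ _ h'] := TL v.+1 vk.
apply: leq_ltn_imp => j ji; have [a [ra ca]] := rc_onto (leq_trans ji (Ly i)).
by move: ji; rewrite -ra -ca -h -h' => /ltnW.
Qed.

Lemma levels_strip T L v i j : is_levels T L -> v < k ->
  row (L v) i <= j < row (L v.+1) i -> exists a, [/\ r a = i, c a = j & T a = v :> nat].
Proof.
move=> TL vk /andP[j1 j2]; have [_ _ h] := TL v (ltnW vk); have [_ Ly h'] := TL v.+1 vk.
have [a [ra ca]] := rc_onto (leq_trans j2 (Ly i)); exists a; split=> //.
have := h a; have := h' a; rewrite ra ca j2 (leq_gtF j1); lia.
Qed.

Lemma levels_strip_row T L v a : is_levels T L -> T a = v :> nat ->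
  row (L v) (r a) <= c a < row (L v.+1) (r a).
Proof.
move=> TL av; have vk : v < k by rewrite -av.
have [_ _ h] := TL v (ltnW vk); have [_ _ h'] := TL v.+1 vk.
by rewrite -h' leqNgt -h av ltnn ltnSn.
Qed.

(** The cells with value v fill the difference of L (v + 1) and L v; strict rows
    mean that no two of them share a row. *)
Lemma levels_vstrip T L : is_levels T L ->
  (row_strict T /\ col_weak T <-> forall v, v < k -> vstrip (L v) (L v.+1)).
Proof.
move=> TL; split=> [[Tr Tc] v vk|vs].
  have [Lp _ _] := TL v (ltnW vk); have [Lp' _ _] := TL v.+1 vk.
  apply/vstripP; split=> // i; rewrite (levels_leq TL) //= leqNgt; apply/negP=> lt.
  have [|a [ra ca av]] := @levels_strip T L v i (row (L v) i) TL vk.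
    by rewrite leqnn (ltn_trans _ lt).
  have [|b [rb cb bv]] := @levels_strip T L v i (row (L v) i).+1 TL vk.
    by rewrite leqnSn lt.
  have := Tr a b; rewrite ra rb ca cb av bv ltnn => /(_ erefl (ltnSn _)).
  by [].
split; last exact: levels_col_weak TL.
move=> a b rab cab; have /andP[_ bv] := levels_strip_row TL (erefl (val (T b))).
have [_ _ h] := TL (T b) (ltnW (ltn_ord _)).
have /vstripP[_ _ /(_ (r b)) /andP[_ v]] := vs _ (ltn_ord (T b)).
by rewrite h rab (leq_trans cab) // -ltnS (leq_trans bv).
Qed.

Definition once T := forall v : 'I_k, exists a, forall b, T b = v <-> b = a.

(** The cells with value v fill the difference of L (v + 1) and L v, which must
    be a single box; conversely, distinct values make weak inequalities strict. *)
Lemma levels_box T L : is_levels T L ->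
  ([/\ once T, row_strict T & col_strict T] <->
   forall v, v < k -> box (L v) (L v.+1)).
Proof.
move=> TL; split=> [[T1 Tr Tc] v vk|bs].
  have [a aP] := T1 (Ordinal vk).
  have Ta : T a = v :> nat by rewrite (proj2 (aP a) erefl).
  have Tinj b : T b = v :> nat -> b = a by move=> Tb; apply/aP; apply: val_inj.
  have [Lp _ _] := TL v (ltnW vk); have [Lp' _ _] := TL v.+1 vk.
  apply/existsP; exists (Ordinal (row_lt_n a)); apply/box_atP; split=> // j /=.
  have lej := levels_leq TL vk j.
  have /andP[a1 a2] := levels_strip_row TL Ta.
  case: (eqVneq j (r a)) => [ja|ja].
    apply/eqP; rewrite eqn_leq addn1 ja (leq_ltn_trans a1 a2) andbT leqNgt.
    apply/negP=> lt.
    have [|b [rb cb /Tinj bv]] := @levels_strip T L v (r a) (row (L v) (r a)) TL vk.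
      by rewrite leqnn (ltn_trans _ lt).
    have [|d [rd cd /Tinj dv]] := @levels_strip T L v (r a) (row (L v) (r a)).+1 TL vk.
      by rewrite leqnSn lt.
    by move: cb cd; rewrite bv dv; lia.
  apply/eqP; rewrite addn0 eqn_leq lej andbT leqNgt; apply/negP=> lt.
  have [|b [rb cb /Tinj bv]] := @levels_strip T L v j (row (L v) j) TL vk.
    by rewrite leqnn lt.
  by case/eqP: ja; rewrite -rb bv.
have T1 : once T.
  move=> v; case/existsP: (bs v (ltn_ord v)) => i /box_atP[_ _ h].
  have [|a [ra ca av]] := @levels_strip T L v i (row (L v) i) TL (ltn_ord v).
    by rewrite leqnn h eqxx addn1 ltnSn.
  exists a => b; split=> [bv|->]; last exact: val_inj.
  have := levels_strip_row TL (congr1 val bv); rewrite h.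
  have [rb|rb] := eqVneq (r b) i; last first.
    by rewrite addn0 => /andP[cb]; rewrite ltnNge cb.
  by rewrite rb addn1 ltnS -eqn_leq => /eqP cb; apply: rc_inj; rewrite ?rb ?ca.
have Tinj a b : T a = T b -> a = b.
  by have [d dP] := T1 (T b) => /dP ->; apply/esym/dP.
split=> // a b e lt; rewrite ltn_neqAle.
- rewrite (levels_row_weak TL) // andbT; apply: contraTneq lt => /val_inj/Tinj->.
  by rewrite ltnn.
rewrite (levels_col_weak TL) // andbT; apply: contraTneq lt => /val_inj/Tinj->.
by rewrite ltnn.
Qed.

Lemma card_row_strict_fillings (A : {set {ffun cells -> 'I_k}}) :
  (forall T, T \in A <-> row_strict T /\ col_weak T) ->
  #|A| = chains (@vstrip n) k y.
Proof.
move=> AP; apply: card_fillings => [T /AP[Tr Tc]|x z /vstripP[xP zP v]|T L TL].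
- by split=> // a b rab cab; apply/ltnW/Tr.
- by split=> // i; case/andP: (v i).
by rewrite AP; apply: levels_vstrip.
Qed.

Lemma card_standard_fillings (A : {set {ffun cells -> 'I_k}}) :
  (forall T, T \in A <-> [/\ once T, row_strict T & col_strict T]) ->
  #|A| = chains (@box n) k y.
Proof.
move=> AP; apply: card_fillings => [T /AP[_ Tr Tc]|x z xz|T L TL].
- by split=> a b e lt; apply/ltnW; [apply: Tr|apply: Tc].
- case/existsP: xz => i /box_atP[xP zP h]; split=> // j.
  by rewrite h leq_addr.
by rewrite AP; apply: levels_box.
Qed.

End Fillings.

(** * Standard and semistandard tableaux *)

(** Row j of the conjugate has more than i boxes exactly when row i has more than
    j, since the rows longer than j come first. *)
Lemma ltn_count_sorted (s : seq nat) i j :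
  sorted geq s -> (i < count (fun r => j < r) s) = (j < nth 0 s i).
Proof.
elim: s i => [|a s IH] i /= sP; first by rewrite nth_nil !ltn0.
have min_a : all (geq a) s by apply: order_path_min sP => x y z /= h1 h2; apply: leq_trans h2 h1.
have [ja|aj] := ltnP j a.
  by case: i => [|i] //=; rewrite add1n ltnS IH // (path_sorted sP).
rewrite (_ : count _ s = 0).
  case: i => [|i] /=; first by rewrite [RHS]ltnNge aj.
  rewrite ltn0; apply/esym/negbTE; rewrite -leqNgt.
  have [is_|si] := ltnP i (size s); last by rewrite nth_default.
  exact: leq_trans (allP min_a _ (mem_nth 0 is_)) aj.
apply/eqP; rewrite eqn0Ngt -has_count; apply/hasPn=> x /(allP min_a) /= xa.
by rewrite -leqNgt (leq_trans xa).
Qed.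

Section ShapeTableaux.

Variables (n : nat) (y : shape n).
Hypothesis yP : is_part y.
Notation sh := (map val y).

Lemma sh_first : first_part sh = row y 0.
Proof. by rewrite /first_part /row nth0. Qed.

Lemma num_SYTE : num_SYT sh = chains (@box n) (area y) y.
Proof.
apply: (card_standard_fillings (r := @row_of sh) (c := @col_of sh)) => //.
- move=> a b ra ca; apply: val_inj; rewrite [val a]surjective_pairing.
  by rewrite [val b]surjective_pairing; congr pair; apply: val_inj.
- by move=> a; apply: (valP a).
- move=> i j ji.
  have i_n : i < size sh.
    by rewrite ltnNge; apply/negP => si; move: ji; rewrite /row nth_default.
  have j_n : j < first_part sh.
    by rewrite sh_first (leq_trans ji) // row_anti.
  by exists (Sub (Ordinal i_n, Ordinal j_n) ji).
move=> T; rewrite inE; split=> [/and3P[T1 Tr Tc]|[T1 Tr Tc]].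
  split=> [v|a b rab cab|a b cab rab].
  - have /cards1P[a aP] := forallP T1 v; exists a => b.
    by move/setP/(_ b): aP; rewrite !inE => e; split=> /eqP ab; apply/eqP; [rewrite -e | rewrite e].
  - by have /forallP/(_ b)/implyP := forallP Tr a; rewrite rab eqxx cab; apply.
  - by have /forallP/(_ b)/implyP := forallP Tc a; rewrite cab eqxx rab; apply.
apply/and3P; split.
- apply/forallP=> v; apply/cards1P; have [a aP] := T1 v; exists a.
  by apply/setP=> b; rewrite !inE; apply/eqP/eqP => /aP.
- by apply/forallP=> a; apply/forallP=> b; apply/implyP=> /andP[/eqP e lt]; apply: Tr.
- by apply/forallP=> a; apply/forallP=> b; apply/implyP=> /andP[/eqP e lt]; apply: Tc.
Qed.

Lemma nth_conjugate i j :
  (i < nth 0 (conjugate sh) j) = (j < row y i).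
Proof.
rewrite -[RHS](ltn_count_sorted i j yP) /conjugate.
have [jf|fj] := ltnP j (first_part sh); first by rewrite nth_mkseq.
rewrite nth_default ?size_mkseq // ltn0 ltn_count_sorted //.
apply/esym/negbTE; rewrite -leqNgt (leq_trans _ fj) //.
by rewrite sh_first -/(row y i) row_anti.
Qed.

(** Exchanging rows and columns turns the cells of the conjugate into those of y,
    weak rows into weak columns and strict columns into strict rows. *)
Lemma num_SSYT_conjugateE k :
  num_SSYT (conjugate sh) k = chains (@vstrip n) k y.
Proof.
apply: (card_row_strict_fillings (r := @col_of (conjugate sh))
                                 (c := @row_of (conjugate sh))) => //.
- move=> a b ca ra; apply: val_inj; rewrite [val a]surjective_pairing.
  by rewrite [val b]surjective_pairing; congr pair; apply: val_inj.
- by move=> a; rewrite -nth_conjugate; apply: (valP a).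
- move=> i j ji; rewrite -nth_conjugate in ji.
  have j_n : j < size (conjugate sh).
    by rewrite ltnNge; apply/negP => sj; move: ji; rewrite nth_default.
  have i_n : i < first_part (conjugate sh).
    by rewrite /first_part -nth0 nth_conjugate; move: ji; rewrite nth_conjugate; apply: leq_trans.
  by exists (Sub (Ordinal j_n, Ordinal i_n) ji).
move=> T; rewrite inE; split=> [/andP[Tr Tc]|[Tc Tr]].
  split=> a b e lt.
    by have /forallP/(_ b)/implyP := forallP Tc a; rewrite e eqxx lt; apply.
  by have /forallP/(_ b)/implyP := forallP Tr a; rewrite e eqxx lt; apply.
apply/andP; split; apply/forallP=> a; apply/forallP=> b; apply/implyP=> /andP[/eqP e lt].
  exact: Tr.
exact: Tc.
Qed.

End ShapeTableaux.

Lemma sum_intpartn n (F : shape n -> nat) :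
  \sum_(la : intpartn n) F (val la) =
  \sum_(y : shape n | is_partition_of n (map val y)) F y.
Proof.
rewrite [RHS](reindex_omap (val : intpartn n -> shape n) insub) /=.
  by apply: eq_bigl => la; rewrite (valP la) valK eqxx.
by move=> y yP; rewrite insubT.
Qed.

Lemma chains_box_part n m (y : shape n) :
  0 < m -> chains (@box n) m y != 0 -> is_part y.
Proof.
case: m => // m _; rewrite /= /down sum_nat_eq0 negb_forall => /existsP[x].
by rewrite negb_imply => /andP[/box_part[]].
Qed.

(** The partitions are grouped by their first part k; full k selects exactly this
    group, since rowstrict k vanishes on longer first rows. *)
Lemma SYT_SSYT_sum n : 0 < n ->
  \sum_(la : intpartn n) num_SYT la * num_SSYT (conjugate la) (first_part la) =
  \sum_(k < n.+1) num_words n (enum 'I_k).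
Proof.
move=> n_gt0.
pose F (y : shape n) := chains (@box n) n y * chains (@vstrip n) (row y 0) y.
rewrite (eq_bigr (fun la : intpartn n => F (val la))) => [|la _]; last first.
  have /andP[laP /eqP la_n] := valP la.
  by rewrite num_SYTE // num_SSYT_conjugateE // sh_first /area la_n.
rewrite sum_intpartn.
transitivity (\sum_(y : shape n) F y).
  rewrite [LHS]big_mkcond; apply: eq_bigr => y _; case: ifP => // /negbT yN.
  apply/esym/eqP; rewrite muln_eq0; apply: contraNT yN.
  rewrite negb_or => /andP[yn _]; apply/andP; split.
    exact: chains_box_part n_gt0 yn.
  exact/eqP/chains_box_area.
rewrite (partition_big (fun y : shape n => Ordinal (leq_ltn_trans (row_le y 0) (ltnSn n))) xpredT) //=.
apply: eq_bigr => k _.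
rewrite -(@syt_sum_full_upto n k n _ (leqnn n)) size_enum_ord // subnn.
rewrite /syt_sum big_mkcond; apply: eq_bigr => y _ /=; rewrite /full -val_eqE /=.
rewrite /F; case: ltngtP => [lt|lt|<-]; rewrite ?mul0n ?muln0 ?mul1n //.
by rewrite rowstrict_row0 // !muln0.
Qed.

(** * Permutations as words *)

Lemma card_ord_lt N m : m <= N -> #|[set i : 'I_N | i < m]| = m.
Proof.
move=> mN; rewrite cardsE -sum1_card -(big_ord_widen N (fun=> 1) mN).
by rewrite sum_nat_const card_ord muln1.
Qed.

Lemma perm_rank N (t : 'S_N) p : #|[set q | t q < t p]| = t p.
Proof.
rewrite -[RHS](@card_ord_lt N) ?(ltnW (ltn_ord _)) // -(card_imset _ (@perm_inj _ t)).
congr #|pred_of_set _|; apply/setP=> i; rewrite inE.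
apply/imsetP/idP => [[q]|ip]; first by rewrite inE => ? ->.
by exists (t^-1%g i); rewrite ?inE permKV.
Qed.

(** A strictly increasing sequence of K letters from an alphabet of size K is the
    whole alphabet in order. *)
Lemma subseq_enum_ordP N K (v : N.-tuple 'I_K) : reflect
  (exists B : {set 'I_N}, #|B| = K /\
     {in B &, forall p q : 'I_N, p < q -> tnth v p < tnth v q})
  (subseq (enum 'I_K) v).
Proof.
have ltN_tr : transitive (fun p q : 'I_N => p < q) by move=> ? ? ?; apply: ltn_trans.
have ltK_tr : transitive (fun p q : 'I_K => p < q) by move=> ? ? ?; apply: ltn_trans.
have enum_sorted m : sorted (fun p q : 'I_m => p < q) (enum 'I_m).
  by have := iota_ltn_sorted 0 m; rewrite -val_enum_ord sorted_map.
apply: (iffP idP) => [|[B [cardB incB]]].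
  case/subseqP=> m _; rewrite -(map_tnth_enum v) -map_mask.
  set t := mask m _ => vt.
  have t_sorted : sorted (fun p q : 'I_N => p < q) t.
    by apply: subseq_sorted (mask_subseq _ _) (enum_sorted N).
  exists [set p in t]; split.
    rewrite cardsE (card_uniqP _); last by rewrite mask_uniq ?enum_uniq.
    by rewrite -(size_map (tnth v)) -vt size_enum_ord.
  move=> p q; rewrite !inE => pt qt pq.
  have ij : index p t < index q t.
    case: (ltngtP (index p t) (index q t)) => // [ji|e].
      by have := sorted_ltn_index ltN_tr t_sorted q p qt pt ji; lia.
    by move: pq; rewrite -(nth_index p pt) e (nth_index p qt) ltnn.
  rewrite -(nth_index p pt) -(nth_index p qt).
  rewrite -!(nth_map p (tnth v p)) ?index_mem // -vt.
  apply: (sorted_ltn_nth ltK_tr) => //; rewrite ?inE vt size_map index_mem //.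
pose t := [seq p <- enum 'I_N | p \in B].
have tB : size t = K.
  rewrite -cardB -(card_uniqP (filter_uniq _ (enum_uniq 'I_N))).
  by apply: eq_card => p; rewrite mem_filter mem_enum andbT.
have vt_sorted : sorted (fun p q : 'I_K => p < q) (map (tnth v) t).
  rewrite sorted_map; apply: (sub_in_sorted (P := mem B)) (_ : sorted (fun p q : 'I_N => p < q) t).
  - by move=> p q pB qB; apply: incB.
  - by apply/allP=> p; rewrite mem_filter => /andP[].
  by apply: sorted_filter.
suff vtE : map (tnth v) t = enum 'I_K.
  rewrite -vtE.
  by rewrite -[X in subseq _ X](map_tnth_enum v) map_subseq // filter_subseq.
have ltK_irr : irreflexive (fun p q : 'I_K => p < q) by move=> p; apply: ltnn.
apply: (irr_sorted_eq ltK_tr ltK_irr vt_sorted (enum_sorted K)).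
have vt_uniq := sorted_uniq ltK_tr ltK_irr vt_sorted.
have vt_sub : {subset map (tnth v) t <= enum 'I_K} by move=> p _; rewrite mem_enum.
have size_vt : size (enum 'I_K) <= size (map (tnth v) t).
  by rewrite [X in _ <= X]size_map tB size_enum_ord.
exact: (uniq_min_size vt_uniq vt_sub size_vt).2.
Qed.

Section Ascents.

Variable n : nat.
Implicit Type s : 'S_n.+1.

Definition val_at s m : nat := s (inord m).
Definition ascs s m := \sum_(l < m) (val_at s l < val_at s l.+1).

Lemma ascE s : asc s = ascs s n.
Proof.
rewrite /ascs /asc.
have -> : [set p : 'I_n.+1 * 'I_n.+1 | (p.2 == p.1.+1 :> nat) && (s p.1 < s p.2)] =
  (fun m : 'I_n => (inord m, inord m.+1)) @: [set m : 'I_n | val_at s m < val_at s m.+1].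
  apply/setP=> -[p q]; rewrite inE /=; apply/idP/imsetP => [/andP[/eqP qp lt]|[m]].
    have pn : p < n by have := ltn_ord q; rewrite qp ltnS.
    have ep : inord p = p :> 'I_n.+1 by apply: inord_val.
    have eq : inord p.+1 = q :> 'I_n.+1 by rewrite -qp inord_val.
    by exists (Ordinal pn); rewrite ?inE /val_at /= ep eq.
  rewrite inE => lt [-> ->]; rewrite lt andbT.
  by rewrite !inordK ?ltnS // ltnW.
rewrite card_in_imset => [|l m _ _ [] /(congr1 val)]; last first.
  by rewrite /= !inordK ?ltnS ?(ltnW (ltn_ord _)) // => /val_inj.
by rewrite cardsE -sum1_card big_mkcond; apply: eq_bigr.
Qed.

Lemma ascsS s m : ascs s m.+1 = ascs s m + (val_at s m < val_at s m.+1).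
Proof. by rewrite /ascs big_ord_recr. Qed.

Lemma ascs_le s i j : i <= j -> ascs s i <= ascs s j.
Proof.
move/subnK <-; elim: (j - i) => // d IH.
by rewrite addSn ascsS (leq_trans IH) ?leq_addr.
Qed.

(** Without an ascent between i and j the values can only go down. *)
Lemma val_at_desc s i j : i <= j -> ascs s j = ascs s i -> val_at s j <= val_at s i.
Proof.
move/subnK <-; elim: (j - i) => // d IH.
rewrite addSn ascsS => e; have := ascs_le s (leq_addl d i).
case: ltnP e => /=; first by lia.
by rewrite addn0 => le /IH le' _; apply: leq_trans le'.
Qed.

Lemma val_at_ord s (i : 'I_n.+1) : val_at s i = s i.
Proof. by rewrite /val_at inord_val. Qed.

Lemma ascs_lt s (i j : 'I_n.+1) : i < j -> s i < s j -> ascs s i < ascs s j.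
Proof.
move=> ij sij; rewrite ltn_neqAle ascs_le ?(ltnW ij) // andbT eq_sym.
apply/negP=> /eqP /(val_at_desc (ltnW ij)); rewrite !val_at_ord; lia.
Qed.

Lemma increasing_onP s (A : {set 'I_n.+1}) : reflect
  {in A &, forall i j : 'I_n.+1, i < j -> s i < s j} (increasing_on s A).
Proof.
apply: (iffP forall_inP) => [h i j iA jA|h i iA].
  by move/forall_inP: (h i iA) => /(_ j jA)/implyP.
by apply/forall_inP=> j jA; apply/implyP; apply: h.
Qed.

Lemma lis_ge s (A : {set 'I_n.+1}) : increasing_on s A -> #|A| <= lis s.
Proof. by move=> sA; apply: leq_bigmax_cond. Qed.

Lemma lis_attained s : exists2 A, increasing_on s A & #|A| = lis s.
Proof.
have [|A sA e] := @eq_bigmax_cond _ (increasing_on s) (fun A => #|A|).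
  apply/card_gt0P; exists set0; rewrite unfold_in; apply/increasing_onP=> i j.
  by rewrite inE.
by exists A.
Qed.

Lemma lis_gt0 s : 0 < lis s.
Proof.
rewrite -(cards1 (ord0 : 'I_n.+1)); apply: lis_ge; apply/increasing_onP=> i j.
by rewrite !inE => /eqP-> /eqP->; rewrite ltnn.
Qed.

Lemma increasing_card s (A : {set 'I_n.+1}) K (w : 'I_n.+1 -> 'I_K) :
  {in A &, forall i j : 'I_n.+1, i < j -> w i < w j} -> #|A| <= K.
Proof.
move=> h; rewrite -[X in _ <= X]card_ord -(@card_in_imset _ _ w) ?max_card // => i j iA jA wij.
by apply: val_inj; case: (ltngtP i j) => // ij;
  [have := h i j iA jA ij | have := h j i jA iA ij]; rewrite wij ltnn.
Qed.

(** Along an increasing subsequence the number of preceding ascents increases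
    strictly, and it takes values between 0 and asc s. *)
Lemma lis_le_asc s : lis s <= (asc s).+1.
Proof.
have [A /increasing_onP sA <-] := lis_attained s.
have le_n (i : 'I_n.+1) : ascs s i < (asc s).+1.
  by rewrite ascE ltnS ascs_le // -ltnS.
apply: (@increasing_card s A _ (fun i => Ordinal (le_n i))) => i j iA jA ij /=.
by apply: ascs_lt => //; apply: sA.
Qed.

Section Words.

Variable k : nat.
Implicit Type v : n.+1.-tuple 'I_k.+1.

(** Equal letters are ordered from right to left, so that they produce descents. *)
Definition lex v p q :=
  (tnth v p < tnth v q) || ((tnth v p == tnth v q) && (q < p)).

Definition sorts s v := forall i j : 'I_n.+1, i < j -> lex v (s i) (s j).

Lemma lex_irr v p : lex v p p = false.
Proof. by rewrite /lex !ltnn andbF. Qed.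

Lemma lex_trans v : transitive (lex v).
Proof. by move=> q p r; rewrite /lex -!val_eqE /=; lia. Qed.

Lemma lex_total v p q : p != q -> lex v p q || lex v q p.
Proof. by rewrite /lex -!val_eqE /=; lia. Qed.

Lemma sorts_lex s v p q : sorts s v -> lex v p q = ((s^-1)%g p < (s^-1)%g q).
Proof.
move=> sv; have h p' q' : (s^-1)%g p' < (s^-1)%g q' -> lex v p' q'.
  by move/sv; rewrite !permKV.
apply/idP/idP => [pq|/h//]; rewrite ltnNge; apply/negP.
rewrite leq_eqVlt => /orP[/eqP/val_inj/perm_inj e|/h qp].
  by move: pq; rewrite e lex_irr.
by have := lex_trans pq qp; rewrite lex_irr.
Qed.

(** The place of a position p in the sorted order is the number of positions that
    precede p in the order lex, which depends on v alone. *)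
Lemma sorts_uniq s s' v : sorts s v -> sorts s' v -> s = s'.
Proof.
move=> sv sv'; apply: invg_inj; apply/permP=> p; apply: val_inj.
rewrite /= -(perm_rank (s^-1)%g) -(perm_rank (s'^-1)%g); congr #|pred_of_set _|; apply/setP=> q.
by rewrite !inE -(sorts_lex _ _ sv) -(sorts_lex _ _ sv').
Qed.

Lemma sorts_ex v : exists s, sorts s v.
Proof.
pose below p := [set q | lex v q p].
have rank_lt p : #|below p| < n.+1.
  rewrite -[X in _ < X]card_ord -cardsT proper_card // properT.
  by apply/negP=> /eqP/setP/(_ p); rewrite !inE lex_irr.
pose t p : 'I_n.+1 := Ordinal (rank_lt p).
have t_lt p q : lex v p q -> t p < t q.
  move=> pq /=; apply: proper_card; apply/properP; split.
    by apply/subsetP=> r; rewrite !inE => rp; apply: lex_trans pq.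
  by exists p; rewrite !inE ?lex_irr.
have t_inj : injective t.
  move=> p q tpq; apply/eqP; apply: contraT => /(lex_total v)/orP[]/t_lt.
    by rewrite tpq ltnn.
  by rewrite tpq ltnn.
exists ((perm t_inj)^-1)%g => i j ij.
set p := (_ i); set q := (_ j).
have pi : t p = i by rewrite -(permE t_inj) permKV.
have qj : t q = j by rewrite -(permE t_inj) permKV.
have pq : p != q by apply: contraTneq ij => e; rewrite -pi -qj e ltnn.
by case/orP: (lex_total v pq) => // /t_lt; rewrite pi qj; lia.
Qed.

(** Two adjacent places carrying equal letters form a descent, so the letters read
    along s go up by at least one at each ascent. *)
Lemma sorts_ascs s v (i j : 'I_n.+1) : sorts s v -> i <= j ->
  tnth v (s i) + ascs s j <= tnth v (s j) + ascs s i.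
Proof.
move=> sv; pose w m := tnth v (s (inord m)).
have wE (l : 'I_n.+1) : tnth v (s l) = w l by rewrite /w inord_val.
rewrite !wE => ij; have := ltn_ord j; rewrite -(subnK ij).
elim: (j - i) => // d IH; rewrite addSn => dn; have := IH (ltnW dn).
rewrite ascsS; set m := d + i in dn *.
have := sv (inord m) (inord m.+1); rewrite !inordK ?(ltnW dn) // => /(_ (ltnSn m)).
rewrite /lex -/(w m) -/(w m.+1) -/(val_at s m) -/(val_at s m.+1) -val_eqE /=.
by case: ltngtP; case: ltngtP => //=; lia.
Qed.

Lemma sorts_asc_le s v : sorts s v -> asc s <= k.
Proof.
move=> sv; have := sorts_ascs sv (leq0n (ord_max : 'I_n.+1) : ord0 <= ord_max).
rewrite ascE /ascs big_ord0 /=; have := ltn_ord (tnth v (s ord_max)); lia.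
Qed.

Lemma sorts_lis_le s v : sorts s v -> lis s <= k.+1.
Proof.
move=> sv; have [A /increasing_onP sA <-] := lis_attained s.
apply: (@increasing_card s A _ (fun i => tnth v (s i))) => i j iA jA ij.
have := sv i j ij; have := sA i j iA jA ij; rewrite /lex; lia.
Qed.

Lemma sorts_lis_ge s v : sorts s v -> subseq (enum 'I_k.+1) v -> k.+1 <= lis s.
Proof.
move=> sv /subseq_enum_ordP[B [cardB incB]].
have inc : increasing_on s (s @^-1: B).
  apply/increasing_onP=> i j; rewrite !inE => iB jB ij.
  case: (ltngtP (s i) (s j)) => // [lt|/val_inj/perm_inj e].
    have := incB _ _ jB iB lt; have := sv i j ij.
    by rewrite /lex -val_eqE /=; case: ltngtP.
  by rewrite e ltnn in ij.
apply: leq_trans (lis_ge inc).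
by rewrite card_preimset ?cardB //; apply: perm_inj.
Qed.

(** For the permutations with k ascents this is the only word over k + 1 letters
    which they sort. *)
Definition word s : n.+1.-tuple 'I_k.+1 := [tuple inord (ascs s ((s^-1)%g p)) | p < n.+1].

Lemma tnth_word s i : asc s = k -> tnth (word s) (s i) = ascs s i :> nat.
Proof.
move=> sk; rewrite tnth_mktuple permK inordK // -sk ascE ltnS ascs_le //.
by rewrite -ltnS.
Qed.

Lemma sorts_word s : asc s = k -> sorts s (word s).
Proof.
move=> sk i j ij; rewrite /lex -val_eqE /= !tnth_word //.
have := ascs_le s (ltnW ij); rewrite leq_eqVlt => /orP[/eqP e|->//].
rewrite e eqxx ltnn /= ltn_neqAle.
have := val_at_desc (ltnW ij) (esym e); rewrite !val_at_ord => -> ; rewrite andbT.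
by apply: contraTneq ij => /val_inj/perm_inj->; rewrite ltnn.
Qed.

Lemma word_full s : asc s = k -> lis s = k.+1 -> subseq (enum 'I_k.+1) (word s).
Proof.
move=> sk sl; apply/subseq_enum_ordP.
have [A /increasing_onP sA cA] := lis_attained s.
exists (s @: A); split; first by rewrite card_imset ?cA //; apply: perm_inj.
move=> _ _ /imsetP[i iA ->] /imsetP[j jA ->] sij.
rewrite !tnth_word // ascs_lt //.
by case: (ltngtP i j) => // [/sA|/val_inj e]; [move=> /(_ jA iA)|move: sij; rewrite e]; lia.
Qed.

(** The letters read along s start at 0 or more, end at k or less and rise at
    each of the k ascents, so they can only rise there, and only by one. *)
Lemma sorts_word_eq s v : asc s = k -> sorts s v -> word s = v.
Proof.
move=> sk sv; apply: eq_from_tnth => p; rewrite -(permKV s p).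
set i := (s^-1)%g p; apply: val_inj; rewrite /= tnth_word //.
have := sorts_ascs sv (leq0n i : ord0 <= i).
have := sorts_ascs sv (leq_ord i : i <= ord_max).
have := ltn_ord (tnth v (s ord_max)).
have a0 : ascs s (@ord0 n) = 0 by rewrite /ascs big_ord0.
have an : ascs s (@ord_max n) = k by rewrite -sk ascE.
by rewrite a0 an; lia.
Qed.

Lemma card_perms_words :
  #|[set s : 'S_n.+1 | (lis s == k.+1) && (asc s == k)]| =
  num_words n.+1 (enum 'I_k.+1).
Proof.
apply: (card_in_bij (f := word)) => [s|s s'|v].
- by rewrite !inE => /andP[/eqP sl /eqP sk]; apply: word_full.
- rewrite !inE => /andP[_ /eqP sk] /andP[_ /eqP sk'] e.
  by have := sorts_word sk'; rewrite -e; apply: sorts_uniq (sorts_word sk).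
rewrite inE => full; have [s sv] := sorts_ex v.
have := sorts_asc_le sv; have := sorts_lis_le sv; have := sorts_lis_ge sv full.
have := lis_le_asc s => h1 h2 h3 h4.
have sk : asc s = k by lia.
exists s; last exact: sorts_word_eq.
by rewrite inE sk eqxx andbT; lia.
Qed.

End Words.

Lemma card_perms_sum :
  #|[set s : 'S_n.+1 | asc s == lis s - 1]| =
  \sum_(k < n.+2) num_words n.+1 (enum 'I_k).
Proof.
(* There is no word of positive length over the empty alphabet. *)
rewrite big_ord_recl [num_words _ _]eq_card0 ?add0n; last first.
  by move=> v; case: (tnth v ord0).
under eq_bigr => k _ do rewrite -card_perms_words.
rewrite -sum1_card (partition_big (fun s => inord (lis s).-1 : 'I_n.+1) xpredT) //=.
apply: eq_bigr => k _; rewrite -sum1_card; apply: eq_bigl => s; rewrite !inE.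
have lis_n : lis s <= n.+1.
  have [A _ <-] := lis_attained s.
  by rewrite -[X in _ <= X]card_ord max_card.
rewrite -val_eqE /= inordK; have := lis_gt0 s; last by lia.
by case: (eqVneq (lis s) k.+1) => [->|] h; [rewrite subn1 eqxx andbT | lia].
Qed.

End Ascents.

Theorem proposition3p7 (n : nat) (hn : 1 <= n) :
  #|[set s : 'S_n | asc s == lis s - 1]| =
  \sum_(la : intpartn n) num_SYT la * num_SSYT (conjugate la) (first_part la).
Proof. by rewrite SYT_SSYT_sum //; case: n hn => // n _; apply: card_perms_sum. Qed.
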